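(* For every $n\geq 0$, the transitive tournament $T_n$ is both diagonal and regularly diagonal, i.e. $\mathrm{MH}_{k,\ell}(T_n)=0$ and $\mathrm{EMH}_{k,\ell}(T_n)=0$ for all $k\ne\ell$.
   Context: $R$ is a fixed commutative unital ring. The transitive tournament $T_n$ is the directed graph on vertices $\{0,\dots,n\}$ with a directed edge $i\to j$ if and only if $i<j$. For a directed graph $G$, $d_G(x,y)$ is the minimal length of a directed path from $x$ to $y$ ($\infty$ if none), and $\mathrm{len}(x_0,\dots,x_k)=\sum_{i=0}^{k-1}d_G(x_i,x_{i+1})$ when all terms are finite. $\mathrm{MC}_{k,\ell}(G)$ is the free $R$-module on tuples $(x_0,\dots,x_k)$ of vertices with $x_i\neq x_{i+1}$ and $d_G(x_i,x_{i+1})<\infty$ for all $i$ and length $\ell$; $\mathrm{EMC}_{k,\ell}(G)$ is the submodule spanned by those tuples whose entries are pairwise distinct. The differential on both is $\partial=\sum_{i=1}^{k-1}(-1)^i\partial_i$, where $\partial_i$ deletes $x_i$ if the resulting tuple still has length $\ell$ and is $0$ otherwise. $\mathrm{MH}_{k,\ell}(G)=H_k(\mathrm{MC}_{*,\ell}(G))$ and $\mathrm{EMH}_{k,\ell}(G)=H_k(\mathrm{EMC}_{*,\ell}(G))$. *)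

(* Defs.v *)
From HB Require Import structures.
From mathcomp Require Import all_boot all_order all_algebra.
From mathcomp Require Import boolp.
From mathcomp Require Import generic_quotient ring_quotient zify.

Set Implicit Arguments.
Unset Strict Implicit.
Unset Printing Implicit Defensive.

Import GRing.Theory.
Local Open Scope quotient_scope.
Local Open Scope ring_scope.

Record chain_complex (R : pzRingType) := ChainComplex {
  chains : nat -> lmodType R;
  diff : forall k, {linear chains k.+1 -> chains k};
  diffK : forall k (c : chains k.+2), diff k (diff k.+1 c) = 0 }.

Section Homology.
Variables (R : pzRingType) (C : chain_complex R).

(* The differential leaving degree 0 is the zero map. *)
Definition is_cycle k : pred (chains C k) :=
  match k with
  | 0 => fun=> true
  | k'.+1 => fun c => diff C k' c == 0
  end.

Fact is_cycle_submod k : submod_closed (@is_cycle k).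
Proof.
case: k => [|k]; first by split.
split; first by rewrite unfold_in /= linear0.
move=> a u v /eqP hu /eqP hv.
by rewrite unfold_in /= linearP hu hv scaler0 addr0.
Qed.
HB.instance Definition _ k :=
  GRing.isSubmodClosed.Build R (chains C k) (@is_cycle k)
    (@is_cycle_submod k).

Definition cycles k := {c : chains C k | is_cycle c}.
HB.instance Definition _ k := SubType.on (cycles k).
HB.instance Definition _ k := Choice.on (cycles k).
HB.instance Definition _ k := [SubChoice_isSubLmodule of cycles k by <:].

Definition is_boundary k : pred (cycles k) :=
  fun z => `[< exists b : chains C k.+1, diff C k b = val z >].

Fact is_boundary_submod k : submod_closed (@is_boundary k).
Proof.
split=> [|a u v /asboolP[bu hu] /asboolP[bv hv]]; apply/asboolP.
  by exists 0; rewrite !linear0.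
by exists (a *: bu + bv); rewrite !linearP /= hu hv.
Qed.
HB.instance Definition _ k :=
  GRing.isSubmodClosed.Build R (cycles k) (@is_boundary k)
    (@is_boundary_submod k).

Definition homology k :=
  Quotient.quot (GRing.ZmodClosed.clone _ (@is_boundary k) _).
HB.instance Definition _ k := Choice.on (homology k).
HB.instance Definition _ k := EqQuotient.on (homology k).
HB.instance Definition _ k := GRing.Zmodule.on (homology k).

Lemma pi_homology_eq k (z z' : cycles k) :
  (\pi_(homology k) z = \pi_(homology k) z') <-> is_boundary (z - z').
Proof.
split=> [/eqP|h]; first by rewrite -Quotient.idealrBE.
by apply/eqP; rewrite -Quotient.idealrBE.
Qed.

Definition homology_scale k (a : R) (h : homology k) : homology k :=
  \pi_(homology k) (a *: repr h).

Lemma pi_scale k a (z : cycles k) :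
  homology_scale a (\pi_(homology k) z) = \pi_(homology k) (a *: z).
Proof.
apply/pi_homology_eq; rewrite -scalerBr.
have /pi_homology_eq h : \pi_(homology k) (repr (\pi_(homology k) z))
    = \pi_(homology k) z.
  by rewrite reprK.
exact: (rpredZ a h).
Qed.

Lemma homologyW k (P : homology k -> Prop) :
  (forall z : cycles k, P (\pi_(homology k) z)) -> forall h, P h.
Proof. by move=> hP h; rewrite -[h]reprK; exact: hP. Qed.

Lemma pi_homologyD k : {morph \pi_(homology k) : x y / x + y}.
Proof. by move=> x y; rewrite Quotient.pi_add. Qed.

Lemma pi_homology0 k : \pi_(homology k) 0 = 0.
Proof. by rewrite !piE. Qed.

Fact homology_scaleA k (a b : R) (h : homology k) :
  homology_scale a (homology_scale b h) = homology_scale (a * b) h.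
Proof. by elim/homologyW: h => z; rewrite !pi_scale scalerA. Qed.
Fact homology_scale1 k : left_id 1 (@homology_scale k).
Proof. by elim/homologyW=> z; rewrite pi_scale scale1r. Qed.
Fact homology_scaleDr k : right_distributive (@homology_scale k) +%R.
Proof.
move=> a; elim/homologyW=> x; elim/homologyW=> y.
by rewrite -pi_homologyD !pi_scale scalerDr pi_homologyD.
Qed.
Fact homology_scaleDl k (h : homology k) :
  {morph (@homology_scale k)^~ h : a b / a + b}.
Proof.
by elim/homologyW: h => z a b; rewrite !pi_scale scalerDl pi_homologyD.
Qed.
HB.instance Definition _ k := GRing.Zmodule_isLmodule.Build R (homology k)
  (@homology_scaleA k) (@homology_scale1 k) (@homology_scaleDr k)
  (@homology_scaleDl k).

Lemma homology_eq0P k :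
  (forall h : homology k, h = 0) <->
  (forall c : chains C k, is_cycle c -> exists b, diff C k b = c).
Proof.
split=> [h0 c hc | hb].
  have /pi_homology_eq : \pi_(homology k) (Sub c hc : cycles k)
      = \pi_(homology k) 0 by rewrite pi_homology0; exact: h0.
  by rewrite subr0 => /asboolW[b hb]; exists b; rewrite hb SubK.
elim/homologyW=> z; rewrite -pi_homology0; apply/pi_homology_eq.
by rewrite subr0; apply/asboolP/hb/valP.
Qed.

End Homology.

Section Digraph.
Variables (V : finType) (e : rel V).

Fact connect_walk x y : connect e x y ->
  exists n, [exists p : n.-tuple V, path e x p && (last x p == y)].
Proof.
move=> /connectP[p ep ->]; exists (size p).
by apply/existsP; exists (in_tuple p); rewrite ep eqxx.
Qed.

(* None stands for an infinite distance. *)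
Definition dist (x y : V) : option nat :=
  match decP (@idP (connect e x y)) with
  | left xy => Some (ex_minn (connect_walk xy))
  | right _ => None
  end.

Lemma dist_NoneP x y : reflect (dist x y = None) (~~ connect e x y).
Proof.
rewrite /dist; case: (decP (@idP (connect e x y))) => [h | /negP h].
  by rewrite h; constructor.
by rewrite h; constructor.
Qed.

Lemma dist_SomeP x y n : dist x y = Some n <->
  (exists p, [/\ path e x p, last x p = y & size p = n]) /\
  (forall p, path e x p -> last x p = y -> (n <= size p)%N).
Proof.
rewrite /dist; case: (decP (@idP (connect e x y))) => [h | h]; last first.
  by split=> // -[[p [ep lp _]] _]; case: h; apply/connectP; exists p.
case: ex_minnP => m /existsP[p /andP[ep /eqP lp]] hmin.
have hle q : path e x q -> last x q = y -> (m <= size q)%N.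
  move=> eq lq; apply: hmin; apply/existsP; exists (in_tuple q).
  by rewrite eq lq eqxx.
split=> [[<-] | [[q [eq lq <-]] hq]].
  by split=> //; exists p; rewrite size_tuple.
congr Some; apply/eqP; rewrite eqn_leq hle //=.
by rewrite -(size_tuple p) hq.
Qed.

Lemma dist_eq0 x y : dist x y = Some 0%N <-> x = y.
Proof.
split=> [/dist_SomeP[[p [_ <- /size0nil->]]] // | <-].
by apply/dist_SomeP; split=> //; exists [::].
Qed.

Lemma dist_triangle x y z a b : dist x y = Some a -> dist y z = Some b ->
  exists2 c, dist x z = Some c & (c <= a + b)%N.
Proof.
move=> /dist_SomeP[[p [ep lp sp]] _] /dist_SomeP[[q [eq lq sq]] _].
have epq : path e x (p ++ q) by rewrite cat_path ep lp.
have lpq : last x (p ++ q) = z by rewrite last_cat lp.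
case E: (dist x z) => [c|]; last first.
  move/dist_NoneP: E => /negP[]; apply/connectP; by exists (p ++ q).
exists c => //; move/dist_SomeP: E => [_ /(_ _ epq lpq)].
by rewrite size_cat sp sq.
Qed.

(* None when some consecutive distance is infinite. *)
Fixpoint len (s : seq V) : option nat :=
  match s with
  | x :: ((y :: _) as s') =>
      if dist x y is Some d then omap (addn d) (len s') else None
  | _ => Some 0%N
  end.

(* len s = Some l already forces all consecutive distances to be finite. *)
Definition generator (l : nat) (s : seq V) : bool :=
  sorted [rel x y | x != y] s && (len s == Some l).

Definition face k (i : 'I_k.+2) (x : k.+2.-tuple V) : k.+1.-tuple V :=
  [tuple tnth x (lift i j) | j < k.+1].

Definition del i (s : seq V) := take i s ++ drop i.+1 s.

Lemma faceE k (i : 'I_k.+2) x : tval (face i x) = del i x.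
Proof.
have x0 := thead x; apply: (@eq_from_nth _ x0) => [|m].
  rewrite size_tuple size_cat size_drop size_takel size_tuple; last exact: ltnW.
  by have := ltn_ord i; lia.
rewrite size_tuple => lm.
have -> : m = Ordinal lm by [].
rewrite -tnth_nth tnth_mktuple (tnth_nth x0) /= /bump.
rewrite nth_cat size_takel ?size_tuple; last exact: ltnW.
case: ltnP => hm; first by rewrite nth_take.
by rewrite nth_drop addSn subnKC.
Qed.

Lemma len_cons2 x y s : len [:: x, y & s] =
  if dist x y is Some d then omap (addn d) (len (y :: s)) else None.
Proof. by []. Qed.

Lemma len_del i s n : (0 < i)%N -> (i.+1 < size s)%N -> len s = Some n ->
  exists2 m, len (del i s) = Some m & (m <= n)%N.
Proof.
case: i => // i _; elim: i s n => [|i IHi] [|x [|y s]] // n.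
  case: s => // z s _; rewrite /del /= ?drop0 -/(len [:: x, y, z & s]).
  rewrite -/(len [:: x, z & s]) !len_cons2.
  case dxy: (dist x y) => [a|] //; case dyz: (dist y z) => [b|] //.
  case: (len (z :: s)) => // m [<-].
  have [c -> lec] := dist_triangle dxy dyz.
  by exists (c + m)%N => //; lia.
move=> si; rewrite len_cons2; case dxy: (dist x y) => [a|] //.
case E: (len (y :: s)) => [m|] // [<-].
have [//|p hp lep] := IHi (y :: s) m _ E.
have -> : del i.+2 [:: x, y & s] = [:: x, y & del i s] by [].
rewrite len_cons2 dxy -[y :: del i s]/(del i.+1 (y :: s)) hp.
by exists (a + p)%N => //; lia.
Qed.

Lemma generator_del i s n : (0 < i)%N -> (i.+1 < size s)%N ->
  generator n s -> len (del i s) = Some n -> generator n (del i s).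
Proof.
move=> i0 si /andP[ns /eqP ls] ld; rewrite /generator ld eqxx andbT.
case: i i0 si ld => // i _; elim: i s n ns ls => [|i IHi] [|x [|y s]] // n.
  case: s => // z s /and3P[nxy nyz ns]; rewrite /= in nxy nyz.
  have -> : del 1 [:: x, y, z & s] = [:: x, z & s] by [].
  rewrite !len_cons2.
  case dxy: (dist x y) => [a|] //; case dyz: (dist y z) => [b|] //.
  case: (len (z :: s)) => // m [<-] _.
  case dxz: (dist x z) => [c|] // [eqc]; apply/andP; split=> /=; last exact: ns.
  apply/eqP => xz; move: dxz; rewrite xz.
  rewrite (proj2 (dist_eq0 z z) erefl) => -[c0].
  suff /dist_eq0 xy : dist x y = Some 0%N by rewrite xy eqxx in nxy.
  by rewrite dxy; congr Some; lia.
move=> /andP[nxy ns]; rewrite /= in nxy; rewrite len_cons2.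
case dxy: (dist x y) => [a|] //; case E: (len (y :: s)) => [m|] // [<-] si.
have si' : (i.+2 < size (y :: s))%N by [].
have [p hp lep] := len_del (ltn0Sn i) si' E.
have -> : del i.+2 [:: x, y & s] = [:: x, y & del i s] by [].
rewrite len_cons2 dxy -[y :: del i s]/(del i.+1 (y :: s)) hp => -[hm].
rewrite /= nxy; apply: (IHi (y :: s) m) => //.
by rewrite hp; congr Some; lia.
Qed.

Section MagnitudeComplex.
Variables (R : comPzRingType) (l : nat).

Definition simplex k := {x : k.+1.-tuple V | generator l x}.
HB.instance Definition _ k := SubType.on (simplex k).
HB.instance Definition _ k := Finite.on (simplex k).

Definition MC k := {ffun simplex k -> R^o}.
HB.instance Definition _ k := GRing.Lmodule.on (MC k).

Definition basis k (x : simplex k) : MC k := [ffun y => (y == x)%:R].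

(* The face of a generator at an interior index is a generator as soon as it
   has length l, see face_generator below. *)
Definition MC_face k (i : 'I_k.+2) (x : simplex k.+1) : MC k :=
  if insub (face i (val x)) is Some y then basis y else 0.

Definition MC_boundary k (x : simplex k.+1) : MC k :=
  \sum_(i < k.+2 | (0 < i < k.+1)%N) (-1) ^+ i *: MC_face i x.

Definition MC_diff k (c : MC k.+1) : MC k := \sum_x (c x : R) *: MC_boundary x.

Fact MC_diff_linear k : linear (@MC_diff k).
Proof.
move=> a u v; rewrite /MC_diff scaler_sumr -big_split /=.
by apply: eq_bigr => x _; rewrite !ffunE scalerDl scalerA.
Qed.
HB.instance Definition _ k := GRing.isLinear.Build R (MC k.+1) (MC k) *:%R
  (@MC_diff k) (@MC_diff_linear k).

Lemma face_generator k (i : 'I_k.+2) (x : simplex k.+1) : (0 < i < k.+1)%N ->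
  generator l (face i (val x)) = (len (face i (val x)) == Some l).
Proof.
move=> /andP[i0 ik]; apply/idP/idP => [/andP[] // | /eqP hl].
rewrite faceE in hl *; apply: generator_del hl => //; first by rewrite size_tuple.
exact: (valP x).
Qed.

Lemma MC_basisE k (c : MC k) : c = \sum_x (c x : R) *: basis x.
Proof.
apply/ffunP=> y; rewrite sum_ffunE (bigD1 y) //= big1 => [|x xy].
  by rewrite !ffunE eqxx addr0 /GRing.scale /= mulr1.
by rewrite !ffunE eq_sym (negPf xy) scaler0.
Qed.

Lemma MC_diff_basis k (x : simplex k.+1) : MC_diff (basis x) = MC_boundary x.
Proof.
rewrite /MC_diff (bigD1 x) //= big1 => [|y yx].
  by rewrite ffunE eqxx scale1r addr0.
by rewrite ffunE (negPf yx) scale0r.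
Qed.

Definition chain_of k (t : k.+1.-tuple V) : MC k :=
  if insub t is Some y then basis y else 0.

Lemma face_face k (i : 'I_k.+3) (j : 'I_k.+2) (x : simplex k.+2) :
    (0 < i < k.+2)%N -> (0 < j < k.+1)%N ->
  (if insub (face i (val x)) is Some y then MC_face j y else 0)
    = chain_of (face j (face i (val x))).
Proof.
move=> /andP[i0 ik] /andP[j0 jk]; case: insubP => [y _ vy | ng].
  by rewrite /MC_face vy.
rewrite /chain_of insubN //; apply: contra ng => /andP[_ /eqP].
have /andP[_ /eqP lx] := valP x.
have [|m hm lem] := len_del i0 _ lx; first by rewrite size_tuple.
rewrite [face j _ : seq V]faceE => h.
have hm' := hm; rewrite -faceE in hm'.
have [|p] := len_del j0 _ hm'; first by rewrite size_tuple.
rewrite h => -[<-] lm.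
have e_ml : m = l by apply/eqP; rewrite eqn_leq lem lm.
rewrite faceE; apply: generator_del => //; last by rewrite hm e_ml.
  by rewrite size_tuple.
exact: (valP x).
Qed.

(* Deleting entry i then entry j is deleting, from the original tuple, the entry
   lift i j and then the remaining copy of i. *)
Definition swap k (p : 'I_k.+3 * 'I_k.+2) : 'I_k.+3 * 'I_k.+2 :=
  (lift p.1 p.2, inord (unbump p.2 p.1)).

Lemma swap_val k (p : 'I_k.+3 * 'I_k.+2) : (swap p).2 = unbump p.2 p.1 :> nat.
Proof.
rewrite /= inordK //; move: (ltn_ord p.1) (ltn_ord p.2); rewrite /unbump.
lia.
Qed.

Lemma swapK k : involutive (@swap k).
Proof.
move=> p; apply: injective_projections; apply: val_inj.
  by rewrite -[LHS]/(bump (swap p).1 (swap p).2) swap_val /= /bump /unbump; lia.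
by rewrite -[LHS]/(nat_of_ord (swap (swap p)).2) !swap_val /= /bump /unbump; lia.
Qed.

Lemma face_swap k (p : 'I_k.+3 * 'I_k.+2) (t : k.+3.-tuple V) :
  face (swap p).2 (face (swap p).1 t) = face p.2 (face p.1 t).
Proof.
apply: eq_from_tnth => m; rewrite !tnth_mktuple; congr (tnth t _).
apply: val_inj; rewrite -[LHS]/(bump (swap p).1 (bump (swap p).2 m)) swap_val.
by rewrite /= /bump /unbump; lia.
Qed.

Fact MC_diffK k (c : MC k.+2) : MC_diff (MC_diff c) = 0.
Proof.
rewrite [c]MC_basisE (linear_sum (@MC_diff k.+1)) (linear_sum (@MC_diff k)).
rewrite big1 //= => x _.
rewrite !linearZ /= MC_diff_basis.
apply/eqP; rewrite -[X in _ == X](scaler0 _ (c x)); apply/eqP; congr (_ *: _).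
pose F (p : 'I_k.+3 * 'I_k.+2) : MC k :=
  (-1) ^+ (p.1 + p.2) *: chain_of (face p.2 (face p.1 (val x))).
pose I (p : 'I_k.+3 * 'I_k.+2) := (0 < p.1 < k.+2)%N && (0 < p.2 < k.+1)%N.
transitivity (\sum_(p | I p) F p).
  rewrite [LHS](linear_sum (@MC_diff k)).
  rewrite -(pair_big_dep (fun i : 'I_k.+3 => 0 < i < k.+2)%N
    (fun _ (j : 'I_k.+2) => 0 < j < k.+1)%N (fun i j => F (i, j))) /=.
  apply: eq_bigr => i hi; rewrite linearZ /= /MC_face.
  transitivity ((-1) ^+ i *: \sum_(j < k.+2 | (0 < j < k.+1)%N) (-1) ^+ j *:
     (if insub (face i (val x)) is Some y then MC_face j y else 0) : MC k).
    congr (_ *: _); case: insubP => [y _ _ | _]; first by rewrite MC_diff_basis.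
    by rewrite linear0 big1 // => j _; rewrite scaler0.
  rewrite scaler_sumr; apply: eq_bigr => j hj.
  by rewrite face_face // scalerA -exprD.
rewrite (bigID (fun p : 'I_k.+3 * 'I_k.+2 => p.2 < p.1)%N) /=.
rewrite [X in _ + X](reindex_inj (inv_inj (@swapK k))).
rewrite -[RHS](subrr (\sum_(p | I p && (p.2 < p.1)%N) F p)).
congr (_ + _); rewrite -sumrN; apply: eq_big => [p | p _].
  rewrite /I swap_val /= /bump /unbump.
  by move: (ltn_ord p.1) (ltn_ord p.2); lia.
rewrite /F face_swap -scaleNr swap_val; congr (_ *: _).
rewrite -[in RHS]signr_odd -signr_odd -signrN; congr (_ ^+ nat_of_bool _).
by rewrite /= /bump /unbump; lia.
Qed.

Definition magnitude_complex : chain_complex R :=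
  @ChainComplex R (fun k => MC k) (fun k => @MC_diff k) MC_diffK.

Definition is_EMC k : pred (MC k) := fun c =>
  `[< exists a : simplex k -> R,
        c = \sum_(x : simplex k | uniq (val x)) a x *: basis x >].

Fact is_EMC_submod k : submod_closed (@is_EMC k).
Proof.
split=> [|r u v /asboolP[a ->] /asboolP[b ->]]; apply/asboolP.
  by exists (fun=> 0); rewrite big1 // => x _; rewrite scale0r.
exists (fun x => r * a x + b x); rewrite scaler_sumr -big_split /=.
by apply: eq_bigr => x _; rewrite scalerDl scalerA.
Qed.
HB.instance Definition _ k :=
  GRing.isSubmodClosed.Build R (MC k) (@is_EMC k) (@is_EMC_submod k).

Lemma is_EMC_basis k (x : simplex k) : uniq (val x) -> basis x \in @is_EMC k.
Proof.
move=> ux; apply/asboolP; exists (fun y => (y == x)%:R).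
rewrite (bigD1 x) //= big1 => [|y /andP[_ /negPf->]]; last by rewrite scale0r.
by rewrite eqxx scale1r addr0.
Qed.

Lemma is_EMCP k (c : MC k) :
  reflect (forall x : simplex k, ~~ uniq (val x) -> c x = 0) (c \in @is_EMC k).
Proof.
apply: (iffP idP) => [/asboolP[a ->] x ux | hc].
  rewrite sum_ffunE big1 // => y uy; rewrite !ffunE.
  by case: eqP => [xy | _]; [rewrite -xy (negPf ux) in uy | rewrite scaler0].
rewrite [c]MC_basisE; apply: rpred_sum => x _.
case ux: (uniq (val x)); first by apply: rpredZ; exact: is_EMC_basis.
by rewrite hc ?ux // scale0r rpred0.
Qed.

Fact is_EMC_diff k (c : MC k.+1) : is_EMC c -> is_EMC (MC_diff c).
Proof.
move=> /asboolP[a ->]; rewrite (linear_sum (@MC_diff k)).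
apply: (@rpred_sum _ (GRing.SubmodClosed.clone _ _ (@is_EMC k) _)) => x ux.
rewrite linearZ /= MC_diff_basis; apply: rpredZ; apply: rpred_sum => i hi.
apply: rpredZ; rewrite /MC_face; case: insubP => [y _ vy|_]; last exact: rpred0.
apply: is_EMC_basis; rewrite vy map_inj_uniq ?enum_uniq //.
exact: inj_comp (elimT (tuple_uniqP _) ux) (@lift_inj _ i).
Qed.

Definition EMC k := {c : MC k | is_EMC c}.
HB.instance Definition _ k := SubType.on (EMC k).
HB.instance Definition _ k := Choice.on (EMC k).
HB.instance Definition _ k := [SubChoice_isSubLmodule of EMC k by <:].

Definition EMC_diff k (c : EMC k.+1) : EMC k :=
  Sub (MC_diff (val c)) (is_EMC_diff (valP c)).

Fact EMC_diff_linear k : linear (@EMC_diff k).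
Proof. by move=> a u v; apply: val_inj; rewrite /= linearP. Qed.
HB.instance Definition _ k := GRing.isLinear.Build R (EMC k.+1) (EMC k) *:%R
  (@EMC_diff k) (@EMC_diff_linear k).

Fact EMC_diffK k (c : EMC k.+2) : EMC_diff (EMC_diff c) = 0.
Proof. by apply: val_inj; rewrite /= MC_diffK. Qed.

Definition eulerian_magnitude_complex : chain_complex R :=
  @ChainComplex R (fun k => EMC k) (fun k => @EMC_diff k) EMC_diffK.

Definition MH k := homology magnitude_complex k.
Definition EMH k := homology eulerian_magnitude_complex k.
HB.instance Definition _ k := GRing.Lmodule.on (MH k).
HB.instance Definition _ k := GRing.Lmodule.on (EMH k).

End MagnitudeComplex.

Definition diagonal (R : comPzRingType) : Prop :=
  forall k l : nat, k <> l -> forall h : MH R l k, h = 0.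

Definition regularly_diagonal (R : comPzRingType) : Prop :=
  forall k l : nat, k <> l -> forall h : EMH R l k, h = 0.

End Digraph.

Definition transitive_tournament (n : nat) : rel 'I_n.+1 :=
  [rel i j : 'I_n.+1 | (i < j)%N].
Arguments transitive_tournament n : clear implicits.

(* Main.v *)
(** In a transitive tournament a vertex reaches another one only along an edge,
    so every finite distance between distinct vertices is 1 and a generating
    tuple with k + 1 entries has length exactly k.  Off the diagonal both chain
    complexes are therefore zero already before passing to homology. *)
Require Import Defs.
From mathcomp Require Import all_boot all_algebra.

Set Implicit Arguments.
Unset Strict Implicit.
Unset Printing Implicit Defensive.

Import GRing.Theory.
Local Open Scope ring_scope.

Lemma homology_eq0_chains (R : pzRingType) (C : chain_complex R) k :
  (forall c : chains C k, c = 0) -> forall h : homology C k, h = 0.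
Proof. by move=> C0; apply/homology_eq0P => c _; exists 0; rewrite (C0 c) linear0. Qed.

(** By transitivity [x] has an edge to every later vertex of a path out of it, in particular to its
    endpoint [y], so [[:: y]] bounds the distance by 1. *)
Lemma dist_transitive (V : finType) (e : rel V) (x y : V) d :
  transitive e -> x != y -> dist e x y = Some d -> d = 1%N.
Proof.
move=> e_tr xy dxy; have /dist_SomeP[[p [ep lp _]] d_min] := dxy.
have exy : e x y.
  case: p ep lp => [_ /= xy' | z p ep lp]; first by rewrite xy' eqxx in xy.
  have /allP := order_path_min e_tr ep; apply.
  by rewrite -lp /= mem_last.
have := d_min [:: y]; rewrite /= exy => /(_ isT erefl).
case: d dxy {d_min} => [/dist_eq0 xy' | [|d]] //.
by rewrite xy' eqxx in xy.
Qed.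

Lemma generator_transitive (V : finType) (e : rel V) l (s : seq V) :
  transitive e -> generator e l s -> l = (size s).-1.
Proof.
move=> e_tr /andP[ns /eqP ls].
elim: s l ns ls => [|x [|y s] IHs] l; [by move=> _ [] | by move=> _ [] |].
rewrite len_cons2 => /andP[xy ns].
case dxy: (dist e x y) => [d|] //.
case ls: (len e (y :: s)) => [m|] // [<-].
by rewrite (dist_transitive e_tr xy dxy) (IHs m).
Qed.

Lemma MC_transitive_eq0 (V : finType) (e : rel V) (R : comPzRingType) k l
    (c : MC e R l k) :
  transitive e -> k <> l -> c = 0.
Proof.
(* A chain is a function on [simplex], and a single point [x] of that type already forces
   [l = k]. *)
move=> e_tr kl; apply/ffunP => x; case: kl.
by rewrite (generator_transitive e_tr (valP x)) size_tuple.
Qed.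

Lemma transitive_diagonal (V : finType) (e : rel V) (R : comPzRingType) :
  transitive e -> diagonal e R.
Proof.
move=> e_tr k l kl; apply: homology_eq0_chains => c.
exact: MC_transitive_eq0.
Qed.

Lemma transitive_regularly_diagonal (V : finType) (e : rel V)
    (R : comPzRingType) :
  transitive e -> regularly_diagonal e R.
Proof.
move=> e_tr k l kl; apply: homology_eq0_chains => c.
(* Equality in the submodule is tested in the ambient [MC], where both [val c] and [val 0]
   vanish. *)
apply: val_inj; rewrite [LHS](MC_transitive_eq0 _ e_tr kl).
by rewrite [RHS](MC_transitive_eq0 _ e_tr kl).
Qed.

Theorem corollary3p7 (R : comPzRingType) (n : nat) :
  diagonal (transitive_tournament n) R /\
  regularly_diagonal (transitive_tournament n) R.
Proof.
have e_tr : transitive (transitive_tournament n).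
  by move=> y x z; apply: ltn_trans.
split; first exact: transitive_diagonal.
exact: transitive_regularly_diagonal.
Qed.
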